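(* Let $n\ge1$ be an integer, let $\sigma_n(x):=e^{-2nx}\sum_{k=0}^\infty\frac{(nx)^{2k}}{(k!)^2}$ for $x\ge0$, and let $\iota:=\inf_{x\ge0}\sigma_n(x)$. Then for all $f,g\in C_b[0,\infty)$ and all $x\ge0$, $$|T(f,g;x)|\le\frac12(1-\sigma_n(x))\cdot osc_{M_n}(f)\cdot osc_{M_n}(g)\le\frac12(1-\iota)\cdot osc_{M_n}(f)\cdot osc_{M_n}(g).$$
   Context: $C_b[0,\infty)$ is the set of continuous bounded real-valued functions on $[0,\infty)$. $M_n$ is the Mirakjan–Favard–Szász operator $M_n(f;x):=e^{-nx}\sum_{k=0}^\infty\frac{(nx)^k}{k!}f\left(\frac kn\right)$, $x\in[0,\infty)$, and $T(f,g;x):=M_n(fg;x)-M_n(f;x)M_n(g;x)$. The oscillation is $osc_{M_n}(f):=\sup\{|f(k/n)-f(l/n)|:0\le k<l<\infty\}$ ($k,l$ integers), and similarly for $g$. *)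

(* Defs.v *)
From HB Require Import structures.
From mathcomp Require Import all_boot all_order all_algebra.
From mathcomp Require Import all_classical all_reals all_analysis.

Set Implicit Arguments.
Unset Strict Implicit.
Unset Printing Implicit Defensive.

Import Order.TTheory GRing.Theory Num.Theory.
Import numFieldNormedType.Exports.

Local Open Scope classical_set_scope.
Local Open Scope ring_scope.

(* A function on [0, +oo[ is represented by a total function on R of which
   only the values on [0, +oo[ matter: continuity is relative to [0, +oo[
   (one-sided at 0), and every definition below evaluates the function only at
   the nodes k / n. *)
Definition Cb (R : realType) (f : R -> R) : Prop :=
  {within `[0, +oo[%classic, continuous f} /\
  [bounded f x | x in `[0, +oo[%classic].

(* Mirakjan-Favard-Szasz operator. The series is the limit of its partial
   sums; it converges absolutely whenever 0 < n, 0 <= x and f is in Cb. *)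
Definition szasz (R : realType) (n : nat) (f : R -> R) (x : R) : R :=
  expR (- (n%:R * x)) *
  limn [series (n%:R * x) ^+ k / k`!%:R * f (k%:R / n%:R)]_k.

Definition szaszT (R : realType) (n : nat) (f g : R -> R) (x : R) : R :=
  szasz n (fun y => f y * g y) x - szasz n f x * szasz n g x.

(* The set is nonempty, and bounded above for f in Cb, so that sup is the
   genuine supremum there. *)
Definition szasz_osc (R : realType) (n : nat) (f : R -> R) : R :=
  sup [set r : R | exists k l : nat,
    (k < l)%N /\ r = `|f (k%:R / n%:R) - f (l%:R / n%:R)|].

Definition szasz_sigma (R : realType) (n : nat) (x : R) : R :=
  expR (- (2 * n%:R * x)) *
  limn [series (n%:R * x) ^+ (2 * k) / k`!%:R ^+ 2]_k.

Definition szasz_iota (R : realType) (n : nat) : R :=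
  inf [set szasz_sigma n x | x in `[0, +oo[%classic].

(* Main.v *)
(** For the Poisson weights [w k], the Chebyshev functional of [u] and [v] is
    half the sum of [w k * w l * (u k - u l) * (v k - v l)] over [k <> l]. Each
    factor is bounded by an oscillation, and the total off-diagonal weight is
    [1 - sigma]. The unnormalised inequality is proved for partial sums, by
    induction, and then passed to the limit. *)
Require Import Defs.
From mathcomp Require Import all_boot all_order all_algebra.
From mathcomp Require Import all_classical all_reals all_analysis.
From mathcomp Require Import ring.

Import Order.TTheory GRing.Theory Num.Theory.
Import numFieldNormedType.Exports.

Local Open Scope classical_set_scope.
Local Open Scope ring_scope.

(** With [a := u N] and [b := v N], this expands the cross terms between a new index [N] and the
    earlier ones, as the induction below requires. *)
Lemma series_chebyshev_functional (R : comPzRingType) (w u v : R^nat) (a b : R)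
    (N : nat) :
  \sum_(0 <= k < N) w k * ((u k - a) * (v k - b)) =
    series (fun k => w k * (u k * v k)) N + series w N * (a * b)
    - series (fun k => w k * u k) N * b - series (fun k => w k * v k) N * a.
Proof.
rewrite /series /= !mulr_suml -big_split -!sumrB /=.
by apply: eq_bigr => k _; ring.
Qed.

(** Passing from [N] to [N.+1] adds to the functional [w N] times the sum over [k < N] of
    [w k * ((u k - u N) * (v k - v N))], and to the bound [w N * (series w N * (p * q))]. The factor
    [series w N] stands where normalised weights would have total mass 1, so truncation does no
    harm. *)
Lemma series_chebyshev_le (R : realFieldType) (w u v : R^nat) (p q : R) (N : nat) :
  (forall k, 0 <= w k) ->
  (forall k l, (k < l)%N -> `|u k - u l| <= p) ->
  (forall k l, (k < l)%N -> `|v k - v l| <= q) ->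
  `|series w N * series (fun k => w k * (u k * v k)) N
    - series (fun k => w k * u k) N * series (fun k => w k * v k) N| <=
  1 / 2 * (series w N ^+ 2 - series (fun k => w k * w k) N) * (p * q).
Proof.
move=> w0 hu hv; elim: N => [|N IH].
  by rewrite /series /= !big_geq // !(mul0r, mulr0, subrr, expr0n, normr0).
have step : `|\sum_(0 <= k < N) w k * ((u k - u N) * (v k - v N))| <=
    series w N * (p * q).
  rewrite /series /= mulr_suml; apply: le_trans (ler_norm_sum _ _ _) _.
  rewrite !big_seq; apply: ler_sum => k; rewrite mem_index_iota => /andP[_ kN].
  by rewrite !normrM ger0_norm// ler_wpM2l// ler_pM ?hu ?hv.
rewrite series_chebyshev_functional in step.
rewrite !seriesSr.
move: step IH (w0 N).
set A := series w N; set H := series _ N; set F := series _ N.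
set G := series _ N; set Q := series _ N.
move=> step IH wN.
(* The diagonal terms [w N ^+ 2 * (u N * v N)] cancel; the new bracket is the sum bounded in
   [step]. *)
have -> : (A + w N) * (H + w N * (u N * v N)) - (F + w N * u N) * (G + w N * v N)
  = (A * H - F * G) + w N * (H + A * (u N * v N) - F * v N - G * u N) by ring.
have -> : 1 / 2 * ((A + w N) ^+ 2 - (Q + w N * w N)) * (p * q)
  = 1 / 2 * (A ^+ 2 - Q) * (p * q) + w N * (A * (p * q)) by field.
apply: le_trans (ler_normD _ _) (lerD IH _).
by rewrite normrM ger0_norm// ler_wpM2l.
Qed.

(** Absolute convergence, by comparison with [M * w k]. *)
Lemma is_cvg_series_mulr_bounded (R : realType) (w u : R^nat) (M : R) :
  (forall k, 0 <= w k) -> (forall k, `|u k| <= M) -> cvgn (series w) ->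
  cvgn (series (fun k => w k * u k)).
Proof.
move=> w0 hu cw; apply: normed_cvg.
apply: (@series_le_cvg _ _ (fun k => M * w k)) => [k|k|k|] //=.
- by rewrite mulr_ge0// (le_trans _ (hu k)).
- by rewrite normrM ger0_norm// mulrC ler_wpM2r.
- exact: is_cvg_seriesZ.
Qed.

Lemma chebyshev_lim_le (R : realType) (w u v : R^nat) (p q M : R) :
  (forall k, 0 <= w k) -> cvgn (series w) ->
  (forall k, `|u k| <= M) -> (forall k, `|v k| <= M) ->
  (forall k l, (k < l)%N -> `|u k - u l| <= p) ->
  (forall k l, (k < l)%N -> `|v k - v l| <= q) ->
  cvgn (series (fun k => w k * w k)) ->
  `|limn (series w) * limn (series (fun k => w k * (u k * v k)))
    - limn (series (fun k => w k * u k)) * limn (series (fun k => w k * v k))| <=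
  1 / 2 * (limn (series w) ^+ 2 - limn (series (fun k => w k * w k))) * (p * q).
Proof.
move=> w0 cw uM vM hu hv cQ.
have cF := is_cvg_series_mulr_bounded _ _ _ _ w0 uM cw.
have cG := is_cvg_series_mulr_bounded _ _ _ _ w0 vM cw.
have uvM k : `|u k * v k| <= M * M by rewrite normrM ler_pM.
have cH := is_cvg_series_mulr_bounded _ _ _ _ w0 uvM cw.
rewrite expr2.
apply: (@ler_cvg_to _ \oo _ _
  (fun N => `|series w N * series (fun k => w k * (u k * v k)) N
    - series (fun k => w k * u k) N * series (fun k => w k * v k) N|)
  (fun N => 1 / 2 * (series w N * series w N - series (fun k => w k * w k) N)
    * (p * q))).
- by apply: cvg_norm; apply: cvgB; apply: cvgM.
- by apply: cvgMr_tmp; apply: cvgMl_tmp; apply: cvgB => //; apply: cvgM.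
- by apply: nearW => N; rewrite -expr2; exact: series_chebyshev_le.
Qed.

Lemma Cb_bounded_nodes (R : realType) (n : nat) (f : R -> R) : Cb f ->
  exists2 M : R, 0 < M & forall k : nat, `|f (k%:R / n%:R)| <= M.
Proof.
move=> [_ /pinfty_ex_gt0[M M0 hM]]; exists M => // k.
by apply: hM; rewrite /= in_itv /= andbT divr_ge0.
Qed.

Lemma szasz_osc_ge (R : realType) (n : nat) (f : R -> R) (k l : nat) :
  Cb f -> (k < l)%N ->
  `|f (k%:R / n%:R) - f (l%:R / n%:R)| <= szasz_osc n f.
Proof.
move=> /(Cb_bounded_nodes _ n)[M _ hM] kl; apply: ub_le_sup; last by exists k, l.
(* An upper bound of the set, so that [sup] dominates each of its elements. *)
exists (M + M) => _ [i [j [_ ->]]].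
by apply: le_trans (ler_normB _ _) (lerD _ _).
Qed.

Lemma szasz_osc_ge0 (R : realType) (n : nat) (f : R -> R) :
  Cb f -> 0 <= szasz_osc n f.
Proof. by move=> hf; apply: le_trans (szasz_osc_ge _ n _ _ _ hf (ltnSn 0)). Qed.

(** Since [exp_coeff t k] is [t ^+ k] over [k!], [szasz_sigma] is the sum of the squared Poisson
    weights, that is, the diagonal mass. *)
Lemma szasz_sigmaE (R : realType) (n : nat) (x : R) :
  szasz_sigma n x = (expR (n%:R * x) ^+ 2)^-1 *
    limn (series (fun k => exp_coeff (n%:R * x) k * exp_coeff (n%:R * x) k)).
Proof.
rewrite /szasz_sigma expRN -mulrA (expRM_natl 2); congr (_ * limn (series _ : R^nat)).
by apply/funext => k; rewrite /exp_coeff /= mulnC exprM -expr2 expr_div_n.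
Qed.

(** Each term of the nonnegative exponential series is at most its sum [expR t], so the squares are
    dominated by [expR t * exp_coeff t k]. *)
Lemma is_cvg_series_exp_coeff_sqr (R : realType) (t : R) : 0 <= t ->
  cvgn (series (fun k => exp_coeff t k * exp_coeff t k)).
Proof.
move=> t0.
have w0 k : 0 <= exp_coeff t k by rewrite exp_coeff_ge0.
apply: (is_cvg_series_mulr_bounded _ _ _ (expR t)) => // [k|].
  rewrite ger0_norm// (le_trans _ (_ : series (exp_coeff t) k.+1 <= _))//.
    by rewrite seriesSr lerDr sumr_ge0.
  apply: nondecreasing_cvgn_le; last exact: is_cvg_series_exp_coeff.
  by apply: nondecreasing_series => i _ _.
exact: is_cvg_series_exp_coeff.
Qed.

Lemma szasz_sigma_ge0 (R : realType) (n : nat) (x : R) :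
  0 <= x -> 0 <= szasz_sigma n x.
Proof.
move=> x0; rewrite szasz_sigmaE mulr_ge0 ?invr_ge0 ?exprn_ge0 ?expR_ge0//.
apply: limr_ge; first by apply: is_cvg_series_exp_coeff_sqr; rewrite mulr_ge0.
by apply: nearW => N; apply: sumr_ge0 => k _; rewrite -expr2 sqr_ge0.
Qed.

Lemma szasz_iota_le (R : realType) (n : nat) (x : R) :
  0 <= x -> szasz_iota R n <= szasz_sigma n x.
Proof.
move=> x0; apply: ge_inf; last by exists x => //=; rewrite in_itv /= x0.
(* The lower bound 0 makes [inf] a genuine infimum. *)
exists 0 => _ [y /= + <-]; rewrite in_itv /= andbT; exact: szasz_sigma_ge0.
Qed.

Theorem theorem6p1 (R : realType) (n : nat) (hn : (1 <= n)%N)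
    (f g : R -> R) (hf : Cb f) (hg : Cb g) (x : R) (hx : 0 <= x) :
  `|szaszT n f g x| <=
     1 / 2 * (1 - szasz_sigma n x) * szasz_osc n f * szasz_osc n g
  /\ 1 / 2 * (1 - szasz_sigma n x) * szasz_osc n f * szasz_osc n g <=
     1 / 2 * (1 - szasz_iota R n) * szasz_osc n f * szasz_osc n g.
Proof.
split; last first.
  rewrite !ler_wpM2r ?szasz_osc_ge0// ler_wpM2l ?divr_ge0// lerD2l lerN2.
  exact: szasz_iota_le.
have t0 : 0 <= n%:R * x by rewrite mulr_ge0.
have [Mf Mf0 hMf] := Cb_bounded_nodes _ n _ hf.
have [Mg Mg0 hMg] := Cb_bounded_nodes _ n _ hg.
(* The weights are the Poisson weights without the factor [expR (- (n%:R * x))]; [Mf + Mg] bounds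
   the node values of both functions. *)
have := chebyshev_lim_le _ (exp_coeff (n%:R * x))
  (fun k => f (k%:R / n%:R)) (fun k => g (k%:R / n%:R))
  (szasz_osc n f) (szasz_osc n g) (Mf + Mg)
  (fun k => exp_coeff_ge0 k t0) (is_cvg_series_exp_coeff _)
  (fun k => ler_wpDr (ltW Mg0) (hMf k)) (fun k => ler_wpDl (ltW Mf0) (hMg k))
  (fun k l => szasz_osc_ge _ n f k l hf) (fun k l => szasz_osc_ge _ n g k l hg)
  (is_cvg_series_exp_coeff_sqr _ _ t0).
rewrite szasz_sigmaE /szaszT /szasz expRN.
rewrite -[limn (series (exp_coeff _))]/(expR (n%:R * x)).
have := expR_gt0 (n%:R * x).
rewrite /exp_coeff /=.
set E := expR _; set H := limn _; set F := limn _; set G := limn _.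
set Q := limn _; set p := szasz_osc n f; set q := szasz_osc n g => E0 main.
have En0 : E != 0 by rewrite gt_eqF.
(* Normalisation: both sides are [(E ^+ 2)^-1] times those of [main]. *)
have -> : E^-1 * H - E^-1 * F * (E^-1 * G) = (E ^+ 2)^-1 * (E * H - F * G).
  by field.
have -> : 1 / 2 * (1 - (E ^+ 2)^-1 * Q) * p * q =
    (E ^+ 2)^-1 * (1 / 2 * (E ^+ 2 - Q) * (p * q)) by field.
have iE : 0 <= (E ^+ 2)^-1 by rewrite invr_ge0 exprn_ge0// ltW.
by rewrite normrM ger0_norm// ler_wpM2l.
Qed.
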